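(* Let $G$ be a finite simple graph. If $|V(G)|\leq 2\chi(G)+1$, then $\mathrm{ch}(G)=\chi(G)$.
   Context: Graphs are finite and simple. $\chi(G)$ denotes the chromatic number of $G$, and $V(G)$ its vertex set. A list assignment $L$ of $G$ assigns to each vertex $v$ of $G$ a set $L(v)$ of colours. An acceptable colouring for $L$ is a proper vertex colouring $f$ of $G$ such that $f(v)\in L(v)$ for every $v\in V(G)$. The graph $G$ is $k$-choosable if there is an acceptable colouring for $L$ whenever $|L(v)|\geq k$ for all $v\in V(G)$. The choice number $\mathrm{ch}(G)$ is the minimum $k$ such that $G$ is $k$-choosable. *)

(* Defs.v *)
From HB Require Import structures.
From mathcomp Require Import all_boot.
From mathcomp Require Import boolp.

Set Implicit Arguments.
Unset Strict Implicit.
Unset Printing Implicit Defensive.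

Record sgraph := SGraph {
  vertex :> finType;
  adj : rel vertex;
  adj_sym : symmetric adj;
  adj_irrefl : irreflexive adj }.

Definition proper_coloring (G : sgraph) (C : eqType) (f : G -> C) : bool :=
  [forall x, forall y, adj x y ==> (f x != f y)].

Definition colorable (G : sgraph) (k : nat) : bool :=
  [exists f : {ffun G -> 'I_k}, proper_coloring f].

Lemma injective_proper (G : sgraph) (C : eqType) (f : G -> C) :
  injective f -> proper_coloring f.
Proof.
move=> fI; apply/forallP=> x; apply/forallP=> y; apply/implyP=> xy.
by apply/eqP=> /fI eq_xy; rewrite eq_xy adj_irrefl in xy.
Qed.

Lemma colorable_exists (G : sgraph) : exists k, colorable G k.
Proof.
exists #|G|; apply/existsP; exists [ffun x => enum_rank x].
by apply: injective_proper => x y; rewrite !ffunE; apply: enum_rank_inj.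
Qed.

Definition chromatic_number (G : sgraph) : nat := ex_minn (colorable_exists G).

Definition acceptable (G : sgraph) (C : finType) (L : G -> {set C})
    (f : G -> C) : Prop :=
  proper_coloring f /\ forall v, f v \in L v.

(* The palette [C] ranges over all finite types: only the finitely many
   colours occurring in the lists of the finitely many vertices matter. *)
Definition choosable (G : sgraph) (k : nat) : Prop :=
  forall (C : finType) (L : G -> {set C}),
    (forall v, k <= #|L v|) -> exists f : G -> C, acceptable L f.

(* Choosing colours greedily, all distinct, shows that [G] is
   [#|G|]-choosable. *)
Lemma choosable_card (G : sgraph) : choosable G #|G|.
Proof.
move=> C L Lge.
have [x0 _|G0] := pickP (@predT G); last first.
  have no (v : G) : False by have := G0 v.
  exists (fun v => False_rect C (no v)).
  by split=> [|v]; [apply/forallP=> v|]; case: (no v).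
have [c0 _] : exists c, c \in L x0.
  by apply/card_gt0P; apply: leq_trans (Lge x0); apply/card_gt0P; exists x0.
suff [f [fI fL]] : exists f : G -> C,
    {in enum G &, injective f} /\ {in enum G, forall v, f v \in L v}.
  exists f; split=> [|v]; last by apply: fL; rewrite mem_enum.
  by apply: injective_proper => x y; apply: fI; rewrite mem_enum.
have: size (enum G) <= #|G| by rewrite -cardE.
elim: (enum G) (enum_uniq G) => [|x s IHs] /=; first by exists (fun _ => c0).
move=> /andP[xs us] lts; have [f [fI fL]] := IHs us (ltnW lts).
have [c cLx cf] : exists2 c, c \in L x & c \notin map f s.
  apply/subsetPn; apply/negP=> /subset_leq_card.
  apply/negP; rewrite -ltnNge (leq_ltn_trans (card_size _)) // size_map.
  exact: leq_trans lts (Lge x).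
have fE v : v \in s -> (v == x) = false.
  by move=> vs; apply: contraNF xs => /eqP <-.
exists (fun v => if v == x then c else f v); split=> [u v|v].
  rewrite !inE; case: (eqVneq u x) => [->|_] /=; case: (eqVneq v x) => [->|_] //=.
  - by move=> _ vs cfv; rewrite cfv map_f in cf.
  - by move=> us' _ fuc; rewrite -fuc map_f in cf.
  - by move=> us' vs; apply: fI.
by rewrite inE; case: eqVneq => [->|_] //=; apply: fL.
Qed.

Lemma choosable_exists (G : sgraph) : exists k, `[< choosable G k >].
Proof. by exists #|G|; apply/asboolP; apply: choosable_card. Qed.

Definition choice_number (G : sgraph) : nat := ex_minn (choosable_exists G).

(* Main.v *)
(* Adding edges, assume that the graph is complete multipartite with k parts,
   and take a counterexample (p, L) with the fewest vertices, then with the most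
   parts, then with the largest lists. Following Noel, Reed and Wu:

   - no colour is common to a part with at least two vertices, and the colours
     can be matched into the vertices; the gap |T| - |C| is positive;
   - call a colour frequent if it lies in more than k lists, or in the lists of
     at least |T| - |C| singleton parts. A proper colouring in which every
     vertex not coloured from its list is alone in its colour class, and has a
     frequent colour, can be repaired ([obstruction]), so there is none;
     hence, by maximality of L, frequent colours lie in all singletons' lists;
   - counting the pairs (v, c) with c in L v shows that the number of frequent
     colours plus the number of singleton parts is at least k. So there are k
     "reserve" colours which are frequent or reserved for one singleton each;
   - colour as many vertices as possible by non-reserve colours, and let j be
     the number of parts whose uncoloured vertices (at least two) are finished
     by one reserve colour each. A further part with two uncoloured vertices
     forces at least k - j coloured vertices, but there are at most k - j if
     the reserve does not suffice for the rest. In this tight case j = 0 and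
     some part is wholly uncoloured; moving non-reserve colours to such parts
     gives a contradiction. *)
Require Import Defs.
From mathcomp Require Import all_boot.
From mathcomp Require Import boolp zify.

Set Implicit Arguments.
Unset Strict Implicit.
Unset Printing Implicit Defensive.

(** * Hall's theorem, with a version for sets of maximal deficiency *)

Section Hall.
Variables X Y : finType.
Implicit Types (r : X -> {set Y}) (A B D : {set X}).

Definition nbhd r A : {set Y} := \bigcup_(x in A) r x.

Lemma nbhdU r A B : nbhd r (A :|: B) = nbhd r A :|: nbhd r B.
Proof. exact: bigcup_setU. Qed.

Lemma nbhd1 r x : nbhd r [set x] = r x.
Proof. exact: big_set1. Qed.

Lemma sub_nbhd r A x : x \in A -> r x \subset nbhd r A.
Proof. by move=> xA; apply: bigcup_sup. Qed.

Lemma nbhdD r A (E : {set Y}) : nbhd (fun x => r x :\: E) A = nbhd r A :\: E.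
Proof.
apply/setP=> y; rewrite inE; apply/bigcupP/idP => [[x xA]|].
  by rewrite inE => /andP[-> yr]; apply/bigcupP; exists x.
by case/andP=> yE /bigcupP[x xA yr]; exists x; rewrite // inE yE.
Qed.

(** Induction on [|D|]. A tight proper nonempty subset [A] is matched first and the rest avoids
    [nbhd r A]; if there is none, any choice at one point leaves Hall's condition intact. [y0] is a
    default value. *)
Lemma hall_set (y0 : Y) r D :
    (forall A, A \subset D -> #|A| <= #|nbhd r A|) ->
  exists f : X -> Y, {in D &, injective f} /\ {in D, forall x, f x \in r x}.
Proof.
have [n] := ubnP #|D|; elim: n r D => // n IHn r D ltDn hallD.
have [->|/set0Pn[x xD]] := eqVneq D set0.
  by exists (fun=> y0); split=> ? ; rewrite inE.
have [/existsP[A /and4P[sAD A0 AD /eqP tight]]|notight] :=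
    boolP [exists A : {set X},
      [&& A \subset D, A != set0, A != D & #|nbhd r A| == #|A|]].
  have ltAD : #|A| < #|D| by rewrite proper_card // properEneq AD.
  have [f [fI fr]] : exists f : X -> Y,
      {in A &, injective f} /\ {in A, forall x, f x \in r x}.
    apply: IHn => [|B sBA]; first exact: leq_trans ltAD _.
    by apply: hallD; apply: subset_trans sBA sAD.
  have [g [gI gr]] : exists f : X -> Y, {in D :\: A &, injective f} /\
      {in D :\: A, forall x, f x \in r x :\: nbhd r A}.
    apply: IHn => [|B].
      by move: A0 ltDn; rewrite cardsD (setIidPr sAD) -card_gt0; lia.
    rewrite subsetD => /andP[sBD dBA]; rewrite nbhdD.
    have := hallD (B :|: A); rewrite subUset sBD sAD => /(_ isT).
    rewrite nbhdU cardsU cardsU (disjoint_setI0 dBA) cards0 subn0.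
    have : #|nbhd r B :&: nbhd r A| <= #|nbhd r B|.
      by rewrite subset_leq_card ?subsetIl.
    rewrite cardsD tight; lia.
  exists (fun x => if x \in A then f x else g x); split=> [u v uD vD|u uD].
    have gN w : w \in D -> w \notin A -> g w \notin nbhd r A.
      by move=> wD wA; have := gr w; rewrite !inE wD wA => /(_ isT)/andP[].
    have fN w : w \in A -> f w \in nbhd r A.
      by move=> wA; apply: (subsetP (sub_nbhd r wA)); apply: fr.
    case: ifPn => uA; case: ifPn => vA.
    - exact: fI.
    - by move=> e; have := gN v vD vA; rewrite -e fN.
    - by move=> e; have := gN u uD uA; rewrite e fN.
    - by apply: gI; rewrite inE ?uA ?vA.
  case: ifPn => uA; first exact: fr.
  by have := gr u; rewrite !inE uA uD => /(_ isT)/andP[].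
have strict A : A \subset D -> A != set0 -> A != D -> #|A| < #|nbhd r A|.
  move=> sAD A0 AD; rewrite ltn_neqAle hallD // andbT.
  apply: contraNneq notight => tight; apply/existsP; exists A.
  by rewrite sAD A0 AD tight eqxx.
have /card_gt0P[y yr] : 0 < #|r x|.
  by have := hallD [set x]; rewrite sub1set xD nbhd1 cards1 => /(_ isT).
have [f [fI fr]] : exists f : X -> Y, {in D :\ x &, injective f} /\
    {in D :\ x, forall u, f u \in r u :\: [set y]}.
  apply: IHn => [|A sAD]; first by move: ltDn; rewrite (cardsD1 x D) xD.
  have [->|A0] := eqVneq A set0; first by rewrite cards0.
  have : #|A| < #|nbhd r A|.
    apply: strict => //; first exact: subset_trans sAD (subsetDl _ _).
    by apply: contraTneq sAD => ->; apply/subsetPn; exists x; rewrite ?inE ?eqxx.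
  by rewrite nbhdD (cardsD1 y (nbhd r A)); case: (_ \in _) => /=; lia.
exists (fun u => if u == x then y else f u); split=> [u v uD vD|u uD].
  have fy w : w \in D -> w != x -> f w != y.
    by move=> wD wx; have := fr w; rewrite !inE wD wx => /(_ isT)/andP[].
  have [->|ux] := eqVneq u x; have [->|vx] := eqVneq v x => // e.
  - by have := fy v vD vx; rewrite -e eqxx.
  - by have := fy u uD ux; rewrite e eqxx.
  - by apply: fI => //; rewrite !inE ?ux ?vx.
have [->//|ux] := eqVneq u x.
by have := fr u; rewrite !inE ux uD => /(_ isT)/andP[].
Qed.

Lemma hall (y0 : Y) r : (forall A, #|A| <= #|nbhd r A|) ->
  exists f : X -> Y, injective f /\ forall x, f x \in r x.
Proof.
move=> hallr; have [|f [fI fr]] := @hall_set y0 r setT => // .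
by exists f; split=> [u v|x]; [apply: fI | apply: fr].
Qed.

Lemma hall_defect (y0 : Y) r : exists S, [/\
    forall A, #|A| + #|nbhd r S| <= #|S| + #|nbhd r A| &
    exists f : X -> Y, {in ~: S &, injective f} /\
      {in ~: S, forall x, f x \in r x :\: nbhd r S}].
Proof.
(* The deficiency [|A| - |nbhd r A|], shifted by [|Y|] so that truncated subtraction is harmless. *)
pose d A := #|A| + (#|Y| - #|nbhd r A|).
have [S _ Smax] := @arg_maxnP _ set0 predT d isT.
have maxS A : #|A| + #|nbhd r S| <= #|S| + #|nbhd r A|.
  have ltY B : #|nbhd r B| <= #|Y| by apply: max_card.
  by have := Smax A isT; have := ltY S; have := ltY A; rewrite /d /=; lia.
(* Adding [A] to [S] cannot raise the deficiency, so [A] has at least [|A|] neighbours outside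
   [nbhd r S]. *)
exists S; split=> //; apply: hall_set => // A sAS; rewrite nbhdD.
have := maxS (A :|: S); rewrite nbhdU cardsU cardsU.
have -> : A :&: S = set0 by apply: disjoint_setI0; rewrite disjoints_subset.
have : #|nbhd r A :&: nbhd r S| <= #|nbhd r A|.
  by rewrite subset_leq_card ?subsetIl.
rewrite cards0 cardsD; lia.
Qed.

End Hall.

(** * Counting and extremal choice *)

Lemma double_count (X Y : finType) (A : {set X}) (B : {set Y})
    (r : X -> {set Y}) :
  \sum_(x in A) #|r x :&: B| = \sum_(y in B) #|[set x in A | y \in r x]|.
Proof.
have card_sum (Z : finType) (E : {set Z}) (P : pred Z) :
    #|[set z in E | P z]| = \sum_(z in E) P z.
  rewrite -sum1_card big_mkcond [RHS]big_mkcond /=.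
  by apply: eq_bigr => z _; rewrite inE; case: (z \in E); case: (P z).
transitivity (\sum_(x in A) \sum_(y in B) (y \in r x : nat)).
  apply: eq_bigr => x _; rewrite -card_sum; congr #|pred_of_set _|.
  by apply/setP=> y; rewrite !inE andbC.
by rewrite exchange_big; apply: eq_bigr => y _; rewrite -card_sum.
Qed.
Lemma sum_leq_eq (J : finType) (B : {set J}) (x y : J -> nat) :
    (forall j, j \in B -> x j <= y j) ->
    \sum_(j in B) y j <= \sum_(j in B) x j ->
  forall j, j \in B -> x j = y j.
Proof.
move=> xy le j jB; have [_] := leqif_sum (fun j jB => leqif_eq (xy j jB)).
rewrite eqn_leq le andbT leq_sum // => /esym/forallP/(_ j)/implyP/(_ jB).
by move/eqP.
Qed.

Lemma subset_of_card (X : finType) (B : {set X}) n : n <= #|B| ->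
  exists D : {set X}, D \subset B /\ #|D| = n.
Proof.
move=> nB; exists [set x in take n (enum B)]; split.
  by apply/subsetP=> x; rewrite inE => /mem_take; rewrite mem_enum.
rewrite cardsE (card_uniqP _) ?take_uniq ?enum_uniq // size_takel //.
by rewrite -cardE.
Qed.

Lemma ffun_argmax (A B : finType) (P : {ffun A -> B} -> Prop)
    (m : {ffun A -> B} -> nat) (f0 : {ffun A -> B}) : P f0 ->
  exists2 f, P f & forall g, P g -> m g <= m f.
Proof.
move=> /asboolP Pf0.
have [f /asboolP Pf fmax] := @arg_maxnP _ f0 (fun f => `[< P f >]) m Pf0.
by exists f => // g /asboolP/fmax.
Qed.

(** List colourings of the subgraph induced on [D] in the complete multipartite graph whose parts
    are the fibres of [p]. *)
Definition part_coloring (T C I : finType) (p : T -> I) (L : T -> {set C})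
    (D : {set T}) (f : T -> C) : Prop :=
  {in D &, forall u v, p u != p v -> f u != f v} /\
  {in D, forall v, f v \in L v}.

(** * First properties of a minimal counterexample *)

Section MinimalCounterexample.
Variables (T C : finType) (k : nat) (p : T -> 'I_k) (L : T -> {set C}).

Definition smaller_colorable := forall (D : {set T}) (L' : T -> {set C}) k',
  #|D| < #|T| -> #|D| <= 2 * k' + 1 -> #|p @: D| <= k' ->
  {in D, forall v, k' <= #|L' v|} -> exists f, part_coloring p L' D f.

Hypothesis leT : #|T| <= 2 * k + 1.
Hypothesis Lk : forall v, k <= #|L v|.
Hypothesis not_colorable : ~ exists f, part_coloring p L setT f.
Hypothesis smaller : smaller_colorable.
Hypothesis p_surj : forall i, exists v, p v = i.
Hypothesis L_cover : forall c, exists v, c \in L v.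

Definition holders c := [set v | c \in L v].
Definition part i := [set v | p v == i].
Definition singles := [set v | #|part (p v)| == 1].
Definition gap := #|T| - #|C|.

Lemma no_coloring f : (forall u v, p u != p v -> f u != f v) ->
  ~ forall v, f v \in L v.
Proof.
by move=> fp fL; apply: not_colorable; exists f; split=> [u v _ _|v _]; auto.
Qed.

Lemma T_inhabited : exists v : T, True.
Proof.
have [v _|T0] := pickP (@predT T); first by exists v.
have no (v : T) : False by have := T0 v.
case: (@no_coloring (fun v => False_rect C (no v))) => v; by case: (no v).
Qed.

Lemma k_gt0 : 0 < k.
Proof. by have [v _] := T_inhabited; case: (k) (p v) => [[]|]. Qed.

Lemma C_inhabited : exists c : C, True.
Proof.
have [v _] := T_inhabited.
by have /card_gt0P[c _] := leq_trans k_gt0 (Lk v); exists c.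
Qed.

Lemma part_gt0 i : 0 < #|part i|.
Proof. by have [v vi] := p_surj i; apply/card_gt0P; exists v; rewrite inE vi. Qed.

Lemma part_single v u : v \in singles -> p u = p v -> u = v.
Proof.
rewrite inE => /cards1P[w ew] e.
have : u \in part (p v) by rewrite inE e.
have : v \in part (p v) by rewrite inE.
by rewrite ew !inE => /eqP-> /eqP->.
Qed.

Lemma card_parts (D : {set T}) : #|D| = \sum_i #|D :&: part i|.
Proof.
rewrite -sum1_card (partition_big p predT) //=; apply: eq_bigr => i _.
by rewrite -sum1_card; apply: eq_bigl => v; rewrite !inE.
Qed.

Lemma card_T_parts : #|T| = \sum_i #|part i|.
Proof.
by rewrite -cardsT card_parts; apply: eq_bigr => i _; rewrite setTI.
Qed.

(** Otherwise give [c] to the whole part: at least two vertices and one part disappear, other lists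
    lose at most one colour, and minimality with [k - 1] colours the rest. *)
Lemma no_common_color i c : 1 < #|part i| ->
  exists v, v \in part i /\ c \notin L v.
Proof.
move=> i1; apply: contrapT => no.
have allc v : p v = i -> c \in L v.
  by move=> vi; apply/negPn/negP=> nc; apply: no; exists v; rewrite inE vi eqxx.
have cD : #|~: part i| + #|part i| = #|T| by rewrite addnC cardsC.
have [|||v _|f [fp fL]] := @smaller (~: part i) (fun v => L v :\ c) k.-1.
- lia.
- by move: leT; have := k_gt0; lia.
- apply: (@leq_trans #|[set~ i]|); last by rewrite cardsC1 card_ord.
  by apply/subset_leq_card/subsetP=> _ /imsetP[v + ->]; rewrite !inE.
- by have := Lk v; have := cardsD1 c (L v); case: (_ \in _) => /=; lia.
have fc v : p v != i -> f v != c /\ f v \in L v.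
  by move=> vi; have := fL v; rewrite !inE vi => /(_ isT) /andP[].
apply: (@no_coloring (fun v => if p v == i then c else f v)) => [u v|v].
  case: ifPn => [/eqP->|ui]; case: ifPn => [/eqP->|vi] //.
  - by rewrite eqxx.
  - by move=> _; rewrite eq_sym; case: (fc v vi).
  - by move=> _; case: (fc u ui).
  - by apply: fp; rewrite inE inE.
by case: ifPn => [/eqP/allc|/fc[]].
Qed.

(** A set of maximal deficiency for [L] must be all of [T]: otherwise minimality colours it, and
    Hall's theorem colours the rest from outside its neighbourhood. Both claims follow from the
    maximality of [T]. *)
Lemma color_matching : #|C| < #|T| /\
  exists M : C -> T, injective M /\ forall c, c \in L (M c).
Proof.
have [c0 _] := C_inhabited; have [v0 _] := T_inhabited.
have [S [Smax [g [gI gL]]]] := hall_defect c0 L.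
have [ST|ST] := eqVneq S setT; last first.
  case: not_colorable; have [||||f [fp fL]] := @smaller S L k.
  - by rewrite -cardsT proper_card // properT.
  - by apply: leq_trans leT; apply: max_card.
  - by rewrite (leq_trans (max_card _)) // card_ord.
  - by move=> v _; apply: Lk.
  have fN v : v \in S -> f v \in nbhd L S.
    by move=> vS; apply: (subsetP (sub_nbhd L vS)); apply: fL.
  have gN v : v \notin S -> g v \notin nbhd L S /\ g v \in L v.
    by move=> vS; have := gL v; rewrite !inE vS => /(_ isT)/andP[].
  exists (fun v => if v \in S then f v else g v); split=> [u v _ _|v _].
    case: ifPn => uS; case: ifPn => vS.
    - exact: fp.
    - by move=> _; apply: contraTneq (fN u uS) => ->; case: (gN v vS).
    - by move=> _; apply: contraTneq (fN v vS) => <-; case: (gN u uS).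
    - by apply: contra => /eqP/gI e; rewrite e ?inE.
  by case: ifPn => vS; [apply: fL | case: (gN v vS)].
have NT : nbhd L S = setT.
  apply/setP=> c; rewrite inE; have [v cv] := L_cover c.
  by apply/bigcupP; exists v; rewrite ?ST.
split.
  rewrite ltnNge; apply/negP=> leTC.
  have [|f [fI fL]] := @hall _ _ c0 L.
    by move=> A; have := Smax A; rewrite NT ST !cardsT; lia.
  by apply: (@no_coloring f) => // u v; apply: contra => /eqP/fI->.
have [|M [MI ML]] := @hall _ _ v0 holders; last first.
  by exists M; split=> // c; have := ML c; rewrite inE.
(* The vertices holding no colour of [A] see at most [|C| - |A|] colours; comparing their deficiency
   with that of [T] gives Hall's condition for [holders]. *)
move=> A; have := Smax (~: nbhd holders A); rewrite NT ST !cardsT.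
have : #|nbhd L (~: nbhd holders A)| <= #|~: A|.
  apply: subset_leq_card; apply/bigcupsP=> v; rewrite inE => vN.
  apply/subsetP=> c cv; rewrite inE; apply: contra vN => cA.
  by apply/bigcupP; exists c; rewrite ?inE.
have := cardsC A; have := cardsC (nbhd holders A).
lia.
Qed.

Lemma gap_gt0 : 0 < gap.
Proof. by case: color_matching => + _; rewrite /gap subn_gt0. Qed.

Lemma card_T_gap : #|T| = #|C| + gap.
Proof. by case: color_matching => + _; rewrite /gap; lia. Qed.

Lemma card_C_ge : k <= #|C|.
Proof.
by have [v _] := T_inhabited; apply: leq_trans (Lk v) _; apply: max_card.
Qed.

(** * Almost acceptable colourings and their obstruction *)

Definition near (E : T -> C -> Prop) (f : T -> C) : Prop :=
  (forall u v, p u != p v -> f u != f v) /\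
  forall v, f v \in L v \/ E v (f v) /\ forall u, f u = f v -> u = v.

(* An unused colour can be given to the vertex matched to it by [M]. *)
Lemma near_surj E f : near E f ->
  exists g, near E g /\ forall c, exists v, g v = c.
Proof.
have [c0 _] := C_inhabited; have [_ [M [MI ML]]] := color_matching.
move=> nf.
pose mu (h : {ffun T -> C}) := #|h @: setT| + #|[set c | h (M c) == c]|.
have nF : near E (finfun f).
  split=> [u v|v]; rewrite !ffunE; first exact: nf.1.
  case: (nf.2 v) => [|[Ev fI]]; [by left | right; split=> // u].
  by rewrite ffunE; apply: fI.
have [h [hp hL] hmax] := ffun_argmax (P := fun h => near E h) mu nF.
exists h; split=> // c; apply: contrapT => hc.
have hNc v : h v <> c by move=> e; apply: hc; exists v.
pose h' := [ffun v => if v == M c then c else h v].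
have nh' : near E h'.
  split=> [u v|v]; rewrite !ffunE.
    case: (u =P M c) => [->|_]; case: (v =P M c) => [->|_].
    - by rewrite eqxx.
    - by move=> _; apply/eqP=> /esym/hNc.
    - by move=> _; apply/eqP=> /hNc.
    - exact: hp.
  case: (v =P M c) => [->|_]; first by left.
  case: (hL v) => [|[Ev hI]]; [by left|right; split=> // u].
  by rewrite ffunE; case: (u =P M c) => [_ /esym/hNc|_] //; apply: hI.
suff : mu h < mu h' by rewrite ltnNge => /negP; apply; apply: hmax.
rewrite /mu -addnS leq_add //.
  have /subset_leq_card : (h @: setT) :\ h (M c) \subset (h' @: setT) :\ c.
    apply/subsetP=> d; rewrite !inE => /andP[dM /imsetP[v _ dv]].
    rewrite dv; apply/andP; split; first by apply/eqP=> /hNc.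
    apply/imsetP; exists v; rewrite // ffunE; case: (v =P M c) => // e.
    by rewrite dv e eqxx in dM.
  have := cardsD1 (h (M c)) (h @: setT); have := cardsD1 c (h' @: setT).
  have -> : c \in h' @: setT.
    by apply/imsetP; exists (M c); rewrite // ffunE eqxx.
  have -> : h (M c) \in h @: setT by apply: imset_f.
  by lia.
apply: proper_card; apply/properP; split.
  apply/subsetP=> d; rewrite !inE ffunE; case: (M d =P M c) => // /MI->.
  by move/eqP/hNc.
exists c; first by rewrite inE ffunE !eqxx.
by rewrite inE; apply/eqP=> /hNc.
Qed.

(* A colour [c] stands for its class [f^-1(c)], which may be recoloured by any
   colour of [r c]. Let [S] be a set of classes of maximal Hall deficiency and
   [K] the set of colours available in [S]. Classes outside [S] are matched
   outside [K], and classes of [S] with several vertices keep their colour. So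
   the one-vertex classes [D] of [S] cannot be coloured by induction from [K]
   minus these few colours, and the only possible reason is that [D] meets too
   many parts. *)
Lemma obstruction E f : near E f ->
  exists v c (K : {set C}) (D : {set T}),
    [/\ [/\ E v c, c \notin K & v \in D], {in D, forall u, L u \subset K},
        #|holders c| + #|K| < #|T| & k < #|p @: D| + gap].
Proof.
have [c0 _] := C_inhabited.
move=> /near_surj[{f} f [[fp fL] fS]].
pose r c := [set d | [forall v, (f v == c) ==> (d \in L v)]].
have rP c d : reflect (forall v, f v = c -> d \in L v) (d \in r c).
  rewrite inE; apply: (iffP forallP) => H v; last by apply/implyP=> /eqP/H.
  by move=> /eqP; apply/implyP/H.
have [S [Smax [phi [phiI phiL]]]] := hall_defect c0 r.
set K := nbhd r S in Smax phiL.
have ltKS : #|K| < #|S|.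
  rewrite ltnNge; apply/negP=> leSK; have [|g [gI gr]] := @hall _ _ c0 r.
    by move=> A; have := Smax A; lia.
  apply: (@no_coloring (g \o f)) => [u v|v] /=.
    by move/fp; apply: contra => /eqP/gI->.
  by have /rP := gr (f v); apply.
have [c cS cK] : exists2 c, c \in S & c \notin K.
  by apply/subsetPn/negP=> /subset_leq_card; rewrite leqNgt ltKS.
have rK d : d \in S -> r d \subset K by apply: sub_nbhd.
have [v [fv Evc vc]] :
    exists v, [/\ f v = c, E v c & forall u, f u = c -> u = v].
  apply: contrapT => no; have : c \in r c.
    apply/rP=> v fv; case: (fL v); rewrite fv // => -[Ev vI].
    by case: no; exists v.
  by move/(subsetP (rK c cS)); apply/negP.
pose alone d := [exists v, f @^-1: [set d] == [set v]].
have aloneP u d : f u = d -> alone d -> forall w, f w = d -> w = u.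
  move=> fu /existsP[x /eqP ex] w fw.
  have : u \in f @^-1: [set d] by rewrite !inE fu.
  have : w \in f @^-1: [set d] by rewrite !inE fw.
  by rewrite ex !inE => /eqP-> /eqP->.
have L_alone u : alone (f u) -> L u \subset r (f u).
  move=> au; apply/subsetP=> d dL; apply/rP=> w fw.
  by rewrite (aloneP u (f u) erefl au w fw).
have ac : alone c.
  apply/existsP; exists v; apply/eqP/setP=> u; rewrite !inE.
  by apply/eqP/eqP=> [/vc|->].
pose Q := [set d in S | ~~ alone d].
pose D := [set u | (f u \in S) && alone (f u)].
have LD u : u \in D -> L u \subset K.
  by rewrite inE => /andP[uS /L_alone]/subset_trans; apply; apply: rK.
have vD : v \in D by rewrite inE fv cS.
have Qr d : d \in Q -> d \in r d.
  rewrite inE => /andP[_ nad]; apply/rP=> u fu; case: (fL u); rewrite fu //.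
  move=> [_ uI]; case/negP: nad; apply/existsP; exists u.
  by apply/eqP/setP=> w; rewrite !inE; apply/eqP/eqP=> [/uI|->].
have QK d : d \in Q -> d \in K.
  by move=> dQ; apply: (subsetP (rK d _)); [case/setIdP: dQ | apply: Qr].
have preim2 d : d \in Q -> 2 <= #|f @^-1: [set d]|.
  rewrite inE => /andP[_ nad]; have [u fu] := fS d.
  rewrite ltn_neqAle eq_sym; apply/andP; split.
    apply: contra nad => /cards1P[x ex]; apply/existsP; exists x.
    by rewrite ex.
  by apply/card_gt0P; exists u; rewrite !inE fu.
have cardf (A : {set C}) : #|f @^-1: A| = \sum_(d in A) #|f @^-1: [set d]|.
  rewrite -sum1_card (partition_big f (mem A)) /=; last by move=> u; rewrite inE.
  apply: eq_bigr => d dA; rewrite -sum1_card; apply: eq_bigl => u.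
  by rewrite !inE; case: eqP => [->|]; rewrite ?dA ?andbF.
have card_fQ : 2 * #|Q| <= #|f @^-1: Q|.
  by rewrite cardf mulnC -sum_nat_const; apply: leq_sum => d /preim2.
have card_fNQ : #|~: Q| <= #|f @^-1: (~: Q)|.
  rewrite cardf -sum1_card; apply: leq_sum => d _.
  by have [u fu] := fS d; apply/card_gt0P; exists u; rewrite !inE fu.
have cQ := cardsC Q; have cfQ := cardsC (f @^-1: Q).
rewrite -preimsetC in cfQ.
(* Every colour is used, and those of [Q] at least twice, so [|T| >= |C| + |Q|]. *)
have leQ : #|Q| <= gap by have := card_T_gap; lia.
exists v, c, K, D; split=> //.
(* As [c] is not in [K], each class of [S] has a vertex whose list misses [c]. *)
- have S_out : #|S| <= #|~: holders c|.
    apply: leq_trans (leq_imset_card f _); apply: subset_leq_card.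
    apply/subsetP=> d dS; have : c \notin r d.
      by apply: contra cK; apply/subsetP/rK.
    rewrite inE negb_forall => /existsP[u]; rewrite negb_imply.
    by move=> /andP[/eqP<- cu]; apply: imset_f; rewrite !inE.
  by have := cardsC (holders c); lia.
(* If [D] met at most [k - gap] parts, minimality would apply with [k - |Q|]: each class of [Q] has
   at least two vertices, all outside [D], and [|Q| <= gap]. *)
rewrite ltnNge; apply/negP=> few.
have DQ0 : D \subset ~: f @^-1: Q.
  by apply/subsetP=> u; rewrite !inE => /andP[-> ->].
have DQ : #|D| + 2 * #|Q| <= #|T|.
  by have := subset_leq_card DQ0; have := cardsC (f @^-1: Q); lia.
have ltDT : #|D| < #|T|.
  rewrite ltnNge; apply/negP=> DT.
  have DTs : D = setT by apply/eqP; rewrite eqEcard subsetT cardsT.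
  have : #|f @: setT| = #|T|.
    rewrite card_imset ?cardsT // => u w fuw.
    have : w \in D by rewrite DTs.
    by rewrite inE => /andP[_ aw]; apply: (aloneP w (f w) erefl aw).
  have : #|f @: setT| <= #|C| by apply: max_card.
  by have := card_T_gap; have := gap_gt0; lia.
have [|||u uD|g [gp gL]] := @smaller D (fun u => L u :\: Q) (k - #|Q|).
- exact: ltDT.
- by lia.
- by lia.
- rewrite cardsD; have := Lk u.
  have := subset_leq_card (subsetIr (L u) Q); lia.
have gKQ u : u \in D -> [/\ g u \in K, g u \notin Q & g u \in L u].
  move=> uD; have := gL u uD; rewrite inE => /andP[-> gu].
  by rewrite (subsetP (LD u uD)) gu.
have phiK d : d \notin S -> phi d \notin K /\ phi d \in r d.
  by move=> dS; have := phiL d; rewrite !inE dS => /(_ isT)/andP[].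
pose h u := if f u \notin S then phi (f u) else if f u \in Q then f u else g u.
have inD u : f u \in S -> f u \notin Q -> u \in D.
  by move=> uS; rewrite !inE uS /= negbK.
apply: (@no_coloring h) => [u w puw|u]; rewrite /h.
  case: (boolP (f u \notin S)) => uS; case: (boolP (f w \notin S)) => wS.
  - by apply: contra (fp _ _ puw) => /eqP/phiI-> //; rewrite inE.
  - apply: contraNneq (phiK _ uS).1 => ->; case: ifPn => [/QK//|wQ].
    by case: (gKQ w) => //; apply: inD; rewrite ?negbK // -[_ \in S]negbK.
  - apply: contraNneq (phiK _ wS).1 => <-; case: ifPn => [/QK//|uQ].
    by case: (gKQ u) => //; apply: inD; rewrite // -[_ \in S]negbK.
  rewrite !negbK in uS wS; case: ifPn => uQ; case: ifPn => wQ.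
  - exact: fp.
  - by apply: contraTneq uQ => ->; case: (gKQ w (inD w wS wQ)).
  - by apply: contraTneq wQ => <-; case: (gKQ u (inD u uS uQ)).
  - by apply: gp => //; apply: inD.
case: ifPn => uS; first by have [_ /rP] := phiK _ uS; apply.
rewrite negbK in uS; case: ifPn => uQ; first by have /rP := Qr _ uQ; apply.
by case: (gKQ u (inD u uS uQ)).
Qed.

(** * Frequent colours *)

Hypothesis L_max : forall v c, c \notin L v -> exists f,
  (forall u w, p u != p w -> f u != f w) /\
  forall u, f u \in L u \/ u = v /\ f u = c.

Definition frequent :=
  [set c | (k < #|holders c|) || (gap <= #|holders c :&: singles|)].

Lemma singles_outside (D : {set T}) : #|p @: D| + #|singles :\: D| <= k.
Proof.
have pI : {in singles :\: D &, injective p}.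
  by move=> u v; rewrite !inE => _ /andP[_ vs] e; apply: part_single; rewrite ?inE.
rewrite -(card_in_imset pI) -[X in _ <= X]card_ord -cardsT -cardsUI.
have -> : p @: D :&: p @: (singles :\: D) = set0.
  apply/setP=> i; rewrite !inE; apply/negP=> /andP[/imsetP[u uD ->]].
  case/imsetP=> v; rewrite inE => /andP[vD vs] e.
  by rewrite -(part_single vs e) uD in vD.
by rewrite cards0 addn0 subset_leq_card ?subsetT.
Qed.

(** An obstruction has [|K| >= k], so its colour [c] has at most [k] holders. The singletons holding
    [c] lie outside [D], and [D] misses fewer than [gap] parts. *)
Lemma no_near_frequent f : ~ near (fun _ c => c \in frequent) f.
Proof.
move=> /obstruction[v [c [K [D [[cF cK vD] LD ltT ltk]]]]].
have kK : k <= #|K| by apply: leq_trans (Lk v) (subset_leq_card (LD v vD)).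
move: cF; rewrite inE => /orP[|many]; first by move: leT; lia.
have : #|holders c :&: singles| <= #|singles :\: D|.
  apply/subset_leq_card/subsetP=> u; rewrite !in_setI in_setD.
  case/andP=> cu ->; rewrite andbT; apply: contra cK => uD.
  by apply: (subsetP (LD u uD)); rewrite inE in cu.
by have := singles_outside D; lia.
Qed.

(** In a colouring given by [L_max] only [v] can be off its list, and then it is alone in its class
    because it is alone in its part. *)
Lemma near_single (E : T -> C -> Prop) v c : v \in singles -> c \notin L v ->
  E v c -> exists f, near E f.
Proof.
move=> vs cv Evc; have [f [fp fL]] := L_max cv; exists f; split=> // u.
case: (fL u) => [|[-> fv]]; [by left | right; rewrite fv].
split=> // w fw; apply: (part_single vs); apply/eqP/negPn/negP=> /fp.
by rewrite fw fv eqxx.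
Qed.

Lemma frequent_sub_single v : v \in singles -> frequent \subset L v.
Proof.
move=> vs; apply/subsetP=> c cF; apply/negPn/negP=> cv.
have [f] := near_single (E := fun _ c => c \in frequent) vs cv cF.
exact: no_near_frequent.
Qed.

Lemma few_singles c : c \notin frequent -> #|holders c :&: singles| < gap.
Proof. by rewrite inE negb_or -!leqNgt ltnNge => /andP[_]; rewrite -ltnNge. Qed.

(** Here [m] is the size of the set [K] of an obstruction. Count in two ways the pairs of a
    singleton in [D] and an infrequent colour of its list: fewer than [gap] singletons lie outside
    [D], and an infrequent colour is in fewer than [gap] singletons' lists. *)
Lemma infrequent_bound c v :
    v \in singles -> c \notin frequent -> c \notin L v ->
  exists m, [/\ #|holders c| + m < #|T|, #|frequent| <= m &
    (#|singles| - gap.-1) * (k - #|frequent|) <= (m - #|frequent|) * gap.-1].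
Proof.
move=> vs cF cv.
have [f nf] := near_single (E := fun v' c' => v' = v /\ c' = c) vs cv
  (conj erefl erefl).
have [_ [_ [K [D [[[-> ->] cK vD] LD ltT ltk]]]]] := obstruction nf.
have FK : frequent \subset K.
  exact: subset_trans (frequent_sub_single vs) (LD v vD).
exists #|K|; split=> //; first exact: subset_leq_card.
have FKD : #|K :\: frequent| = #|K| - #|frequent|.
  by rewrite cardsD (setIidPr FK).
apply: (@leq_trans (\sum_(u in singles :&: D) #|L u :&: (K :\: frequent)|)).
  apply: (@leq_trans (#|singles :&: D| * (k - #|frequent|))).
    rewrite leq_mul2r; apply/orP; right.
    have := singles_outside D; have := cardsID D singles; have := gap_gt0; lia.
  rewrite -sum_nat_const; apply: leq_sum => u; rewrite inE => /andP[us uD].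
  rewrite setIDA (setIidPl (LD u uD)) cardsD (setIidPr (frequent_sub_single us)).
  exact: leq_sub2r.
rewrite double_count -FKD -sum_nat_const; apply: leq_sum => d.
rewrite inE => /andP[/few_singles dF _].
have : #|[set x in singles :&: D | d \in L x]| <= #|holders d :&: singles|.
  apply/subset_leq_card/subsetP=> u.
  by rewrite !inE => /andP[/andP[-> _] ->].
have := gap_gt0; lia.
Qed.

(** * Counting frequent colours and singleton parts *)

Definition big := [set i | 1 < #|part i|].

Lemma card_big : #|big| + #|singles| = k.
Proof.
have pI : {in singles &, injective p}.
  by move=> u v _ vs; apply: part_single.
rewrite -(card_in_imset pI) -[RHS]card_ord -[RHS](cardC (mem big)).
congr (_ + _); apply: eq_card => i; rewrite !inE -leqNgt.
apply/imsetP/idP => [[v + ->]|]; first by rewrite inE => /eqP->.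
move=> le1; have [v vi] := p_surj i; exists v => //.
by rewrite inE vi eqn_leq le1 part_gt0.
Qed.

Lemma holders_le c : #|holders c| + #|big| <= #|T|.
Proof.
rewrite -(cardsC (holders c)) leq_add2l.
apply: leq_trans (leq_imset_card p _); apply/subset_leq_card/subsetP=> i.
rewrite inE => /no_common_color-/(_ c)[v [/[!inE]/eqP<- cv]].
by apply: imset_f; rewrite !inE.
Qed.

Lemma card_lists : k * #|T| <= \sum_c #|holders c|.
Proof.
have <- : \sum_(c in setT) #|[set v in setT | c \in L v]| = \sum_c #|holders c|.
  apply: eq_big => [c|c _]; first by rewrite inE.
  by apply: eq_card => v; rewrite !inE.
rewrite -double_count mulnC -cardsT -sum_nat_const.
by apply: leq_sum => v _; rewrite setIT.
Qed.

(** The weight [w], taken to be [1] and then [gap - 1], avoids division in the bounds for infrequent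
    colours. *)
Lemma card_lists_split (w : nat) : w * (k * #|T|) <=
  #|frequent| * (w * (#|T| - #|big|)) +
  \sum_(c in ~: frequent) w * #|holders c|.
Proof.
apply: (@leq_trans (\sum_c w * #|holders c|)).
  by rewrite -big_distrr leq_mul2l card_lists orbT.
rewrite (bigID (mem frequent)) /= leq_add //; last first.
  by rewrite (eq_bigl (mem (~: frequent))) // => c; rewrite !inE.
rewrite -sum_nat_const; apply: leq_sum => c _.
by rewrite leq_mul //; have := leq_sub2r #|big| (holders_le c); rewrite addnK.
Qed.

Lemma frequent_or_single : k <= #|frequent| + #|singles|.
Proof.
rewrite leqNgt; apply/negP=> few.
have kpos := k_gt0; have gpos := gap_gt0; have Tgap := card_T_gap.
have cbig := card_big; have leC := card_C_ge; have cF := cardsC frequent.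
(* An infrequent colour has at most [k] holders, a frequent one at most
   [|T| - |big| <= k + 1 + |singles|]. *)
have crude : k * gap <= #|frequent| * (#|singles| + 1).
  have := card_lists_split 1.
  have : \sum_(c in ~: frequent) 1 * #|holders c| <= #|~: frequent| * k.
    rewrite -sum_nat_const; apply: leq_sum => c.
    by rewrite !inE negb_or -!leqNgt mul1n => /andP[].
  have := leq_mul2l #|frequent| #|T| (2 * k + 1); rewrite leT orbT.
  nia.
have F_lt : #|frequent| < k by lia.
(* With [gap = 1], every colour in a singleton's list is frequent; without singletons, [crude] gives
   [k <= |frequent|]. *)
have gap2 : 2 <= gap.
  rewrite ltn_neqAle gpos andbT; apply/eqP=> g1.
  have [s0|/set0Pn[v vs]] := eqVneq singles set0.
    by move: crude; rewrite s0 cards0 -g1; lia.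
  suff /subset_leq_card : L v \subset frequent by have := Lk v; lia.
  apply/subsetP=> c cv; rewrite inE -g1; apply/orP; right.
  by apply/card_gt0P; exists v; rewrite in_setI vs inE cv.
(* Two vertices forming a part have disjoint lists, so [|C| >= 2 * k], too many for [gap >= 2]. *)
have big3 i : i \in big -> 3 <= #|part i|.
  rewrite inE => i2; rewrite ltn_neqAle i2 andbT eq_sym; apply/negP=> /cards2P.
  move=> [u [v [uv e]]]; have : #|L u :|: L v| <= #|C| by apply: max_card.
  rewrite cardsU (_ : L u :&: L v = set0) ?cards0; last first.
    apply/setP=> c; rewrite !inE; apply/negP=> /andP[cu cv].
    have [w []] := no_common_color c i2.
    by rewrite e !inE => /orP[]/eqP->; rewrite ?cu ?cv.
  have := Lk u; have := Lk v; move: leT; lia.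
have bigT : k + 2 * #|big| <= #|T|.
  have -> : k + 2 * #|big| = \sum_(i < k) (1 + 2 * (i \in big)).
    rewrite big_split /= sum1_card card_ord -big_distrr /= -sum1_card big_mkcond.
    by congr (_ + 2 * _); apply: eq_bigr => i _; case: (i \in big).
  rewrite card_T_parts; apply: leq_sum => i _; have := part_gt0 i.
  by have [/big3|] := boolP (i \in big); lia.
have Fsmall : 2 * #|frequent| + 1 <= k by move: leT; lia.
have Fpos : 0 < #|frequent| by move: crude; case: #|frequent|; lia.
have manys : 2 * gap <= #|singles| by nia.
pose g := gap.-1; pose e := #|singles| - 2 * g.
(* As [m <= 2 * k - |holders c|], the double count sharpens the crude bound [g * k] by a term in
   [e]. *)
have refined c : c \notin frequent ->
    g * #|holders c| + (k - #|frequent|) * e <= g * k.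
  move=> cN; have := few_singles cN => fs.
  have [v vs cv] : exists2 v, v \in singles & c \notin L v.
    have : ~~ (singles \subset holders c :&: singles).
      by apply/negP=> /subset_leq_card; lia.
    case/subsetPn=> v vs; rewrite in_setI vs andbT inE => cv.
    by exists v.
  have [m [lem Fm]] := infrequent_bound vs cN cv.
  rewrite -/g; have : #|singles| - g = e + g by rewrite /e /g; lia.
  move=> ->; move: leT lem Fm F_lt.
  move: #|holders c| #|frequent| #|T| (e) (g) => n a N e' g'.
  nia.
have := card_lists_split g.
have : \sum_(c in ~: frequent) (g * #|holders c| + (k - #|frequent|) * e)
    <= #|~: frequent| * (g * k).
  by rewrite -sum_nat_const; apply: leq_sum => c; rewrite inE => /refined.
rewrite big_split /= sum_nat_const.
have Tb : #|T| - #|big| <= k + 1 + #|singles| by move: leT; lia.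
have es : #|singles| = e + 2 * g by rewrite /e /g; lia.
have Te : #|T| = #|frequent| + #|~: frequent| + g + 1 by rewrite /g; lia.
have Cg : g <= #|~: frequent| by rewrite /g; lia.
have g1 : 0 < g by rewrite /g; lia.
have ka : #|frequent| + 1 <= k - #|frequent| by lia.
(* After division by [g], [low1] and [up] lead to [k * (g + 1) + e <= |frequent| * (2 * g + 1)],
   which [low2] refutes. *)
have low1 : g * ((#|frequent| + 1) * e) <=
    #|~: frequent| * ((k - #|frequent|) * e).
  by rewrite leq_mul // leq_mul2r ka orbT.
have low2 : g * ((g + 1) * (2 * #|frequent| + 1)) <= g * ((g + 1) * k).
  by rewrite !leq_mul2l [_ + 1 <= _]Fsmall !orbT.
have up : #|frequent| * (g * (#|T| - #|big|)) <=
    #|frequent| * (g * (k + 1 + (e + 2 * g))).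
  by rewrite !leq_mul2l -es Tb !orbT.
rewrite Te in up *; move: low1 low2 up; clearbody g e.
move: (\sum_(_ in _) _) (_ - #|big|) (_ * ((k - _) * e)) => S1 B S2.
move: #|frequent| #|~: frequent| => a b.
clear -g1.
nia.
Qed.

(** * Completing partial colourings with reserve colours *)

Section Extension.
Variables (A : {set C}) (Z : {set T}) (zeta : T -> C).
Hypothesis A_frequent : A \subset frequent.
Hypothesis Z_singles : Z \subset singles.
Hypothesis zeta_inj : {in Z &, injective zeta}.
Hypothesis zeta_L : {in Z, forall v, zeta v \in L v :\: A}.
Hypothesis card_AZ : #|A| + #|Z| = k.

(* The colours of [reserve] are kept for the vertices that a partial colouring
   by the other colours misses: those of [A] may go to any single vertex by
   [no_near_frequent], and [zeta v] is reserved for the singleton part [v]. *)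
Definition reserve := A :|: zeta @: Z.

Lemma card_reserve : #|reserve| = k.
Proof.
rewrite cardsU (_ : A :&: zeta @: Z = set0) ?cards0 ?subn0.
  by rewrite card_in_imset.
apply/setP=> c; rewrite !inE; apply/negP=> /andP[cA /imsetP[v /zeta_L + e]].
by rewrite inE -e cA.
Qed.

Definition partial (h : {ffun T -> option C}) :=
  (forall v c, h v = Some c -> [/\ c \in L v, c \notin reserve & v \notin Z]) /\
  forall u v c, h u = Some c -> h v = Some c -> p u = p v.

Definition dom (h : {ffun T -> option C}) := [set v | h v != None].
Definition class (h : {ffun T -> option C}) d := [set v | h v == Some d].
Definition unc (h : {ffun T -> option C}) i := [set v in part i | h v == None].

Definition max_partial h :=
  partial h /\ forall h', partial h' -> #|dom h'| <= #|dom h|.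

Lemma unc_part h i : unc h i \subset part i.
Proof. by apply/subsetP=> v; rewrite inE => /andP[]. Qed.

Lemma unc_big h i : 1 < #|unc h i| -> i \in big.
Proof.
by rewrite inE => /leq_trans; apply; apply/subset_leq_card/unc_part.
Qed.

Lemma big_notin_Z i v : i \in big -> v \in part i -> v \notin Z.
Proof.
rewrite !inE => i1 /eqP vi; apply: contraL i1 => /(subsetP Z_singles).
by rewrite inE vi => /eqP->.
Qed.

Lemma sum_unc h : \sum_i #|unc h i| + #|dom h| = #|T|.
Proof.
rewrite -(cardsC (dom h)) addnC; congr (_ + _); rewrite card_parts.
apply: eq_bigr => i _; apply: eq_card => v.
by rewrite !inE negbK andbC.
Qed.

Lemma dom_class h : partial h -> #|dom h| = \sum_(d in ~: reserve) #|class h d|.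
Proof.
move=> [hL _]; rewrite -sum1_card.
have [c0 _] := C_inhabited.
rewrite (partition_big (fun v => odflt c0 (h v)) (mem (~: reserve))) /=.
  apply: eq_bigr => d dN; rewrite -sum1_card; apply: eq_bigl => v.
  by rewrite !inE; case: (h v).
by move=> v; rewrite inE in_setC; case hv: (h v) => [c|//] _; case: (hL v c hv).
Qed.

(** Giving [d] to such vertices too would enlarge the domain; none of them is in [Z], as [i] is in
    [big]. *)
Lemma max_inside h d i v : max_partial h -> d \notin reserve -> i \in big ->
  h v = Some d -> v \in part i -> holders d :&: unc h i = set0.
Proof.
move=> [[hL hp] hmax] dN ib hv vi; apply/eqP; rewrite -cards_eq0 -leqn0.
pose h' := [ffun u => if u \in holders d :&: unc h i then Some d else h u].
have pd u : h' u = Some d -> p u = i.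
  rewrite ffunE; case: ifP => [|_ hu].
    by rewrite !inE => /and3P[_ /eqP].
  by rewrite (hp u v d) //; move: vi; rewrite inE => /eqP.
have h'E u c : h' u = Some c -> c = d \/ h u = Some c.
  by rewrite ffunE; case: ifP => _; [case=> <-; left | right].
have : partial h'.
  split=> [u c|u w c hu hw]; last first.
    have [cd|hu'] := h'E u c hu; first by subst c; rewrite !pd.
    have [cd|hw'] := h'E w c hw; first by subst c; rewrite !pd.
    exact: hp hu' hw'.
  rewrite ffunE; case: ifP => [|_ /hL//].
  rewrite 2!inE => /andP[du ui] [<-]; split=> //.
  exact: big_notin_Z ib (subsetP (unc_part h i) u ui).
move/hmax; suff -> : dom h' = dom h :|: (holders d :&: unc h i).
  rewrite cardsU (_ : dom h :&: _ = set0) ?cards0; last first.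
    by apply/setP=> u; rewrite !inE; case: (h u) => [c|]; rewrite ?andbF //= ?andbF.
  by lia.
apply/setP=> u; rewrite in_setU [u \in dom h']inE [u \in dom h]inE ffunE.
by case: ifP => _; rewrite ?orbT ?orbF.
Qed.

Definition move h d i : {ffun T -> option C} :=
  [ffun v => if v \in holders d :&: unc h i then Some d
             else if h v == Some d then None else h v].

Lemma partial_move h d i : partial h -> d \notin reserve -> i \in big ->
  partial (move h d i).
Proof.
move=> [hL hp] dN ib; have mE u c : move h d i u = Some c ->
    (c = d /\ u \in holders d :&: unc h i) \/ (c <> d /\ h u = Some c).
  rewrite ffunE; case: ifP => [_ [<-]|_]; first by left.
  by case: eqP => // hd hu; right; split=> // cd; apply: hd; rewrite hu cd.
split=> [u c /mE|u w c /mE hu /mE hw].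
  case=> [[->]|[_ /hL//]]; rewrite 2!inE => /andP[du ui]; split=> //.
  exact: big_notin_Z ib (subsetP (unc_part h i) u ui).
case: hu => -[cd hu]; case: hw => -[cd' hw] //; last exact: hp hu hw.
by move: hu hw; rewrite !inE => /and3P[_ /eqP-> _] /and3P[_ /eqP-> _].
Qed.

Lemma dom_move h d i :
  #|dom (move h d i)| + #|class h d| = #|dom h| + #|holders d :&: unc h i|.
Proof.
have -> : dom (move h d i) = (dom h :\: class h d) :|: (holders d :&: unc h i).
  apply/setP=> u; rewrite in_setU in_setD [u \in dom (move _ _ _)]inE.
  rewrite [u \in dom h]inE [u \in class _ _]inE ffunE.
  by case: ifP => _; rewrite ?orbT ?orbF //; case: (h u == Some d).
have sub : class h d \subset dom h.
  by apply/subsetP=> u; rewrite !inE => /eqP->.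
rewrite cardsU (_ : _ :&: (_ :&: _) = set0); last first.
  by apply/setP=> u; rewrite !inE; case: (h u) => [c|]; rewrite ?andbF //= ?andbF.
rewrite cards0 subn0 cardsD (setIidPr sub); have := subset_leq_card sub.
lia.
Qed.

Lemma max_class h d i : max_partial h -> d \notin reserve -> i \in big ->
  #|holders d :&: unc h i| <= #|class h d|.
Proof.
move=> [hh hmax] dN ib; have := hmax _ (partial_move hh dN ib).
by have := dom_move h d i; lia.
Qed.

(* [e i = Some c]: the colour [c] is used on all uncoloured vertices of the
   part [i]. *)
Definition reserve_cover h (e : {ffun 'I_k -> option C}) :=
  (forall i c, e i = Some c ->
     [/\ c \in reserve, 1 < #|unc h i| & unc h i \subset holders c]) /\
  forall i j c, e i = Some c -> e j = Some c -> i = j.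

Definition assigned (e : {ffun 'I_k -> option C}) := [set i | e i != None].

(** Otherwise the reserve suffices: [e] finishes its parts, vertices of [Z] take their [zeta]
    colours where [e] leaves them free, and all others take distinct colours of [A], possibly off
    their lists. This contradicts [no_near_frequent]. *)
Lemma reserve_cover_few h (e : {ffun 'I_k -> option C}) :
    partial h -> reserve_cover h e ->
  k < #|assigned e| + \sum_(i in ~: assigned e) #|unc h i|.
Proof.
move=> [hL hp] [eC eI]; rewrite ltnNge; apply/negP=> room.
have [c0 _] := C_inhabited.
pose F1 := [set c | [exists i, e i == Some c]].
have F1P c : reflect (exists i, e i = Some c) (c \in F1).
  by rewrite inE; apply: (iffP existsP) => -[i ei]; exists i; apply/eqP.
have card_F1 : #|F1| = #|assigned e|.
  rewrite -(card_imset _ (@Some_inj _ : injective (@Some C))).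
  rewrite -(@card_in_imset _ _ e); last first.
    move=> i j; rewrite !inE; case ei: (e i) => [c|//] _ _ /esym ej.
    exact: eI ei ej.
  apply: eq_card => o; apply/imsetP/imsetP=> [[c /F1P[i ei] ->]|[i]].
    by exists i; rewrite ?inE ei.
  rewrite inE; case ei: (e i) => [c|//] _ ->.
  by exists c => //; apply/F1P; exists i.
have F1_sub : F1 \subset reserve.
  by apply/subsetP=> c /F1P[i /eC[]].
pose R := [set v | (h v == None) && (e (p v) == None)].
have card_R : #|R| = \sum_(i in ~: assigned e) #|unc h i|.
  rewrite -sum1_card (partition_big p (mem (~: assigned e))) /=; last first.
    by move=> v; rewrite !inE negbK => /andP[].
  apply: eq_bigr => i; rewrite !inE negbK => ei.
  rewrite -sum1_card; apply: eq_bigl => v.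
  by rewrite !inE andbC; case: eqP => //= ->; rewrite ei andbT.
pose Z1 := [set v in Z | zeta v \notin F1].
have Z1R : Z1 \subset R.
  apply/subsetP=> v; rewrite !inE => /andP[vZ _]; apply/andP; split.
    by case hv: (h v) => [c|//]; have [_ _] := hL v c hv; rewrite vZ.
  case ev: (e (p v)) => [c|//]; have [_ /unc_big vb _] := eC _ _ ev.
  by have := big_notin_Z vb (v := v); rewrite inE eqxx vZ => /(_ isT).
have card_AF : #|R :\: Z1| <= #|A :\: F1|.
  have e1 : reserve :\: F1 = (A :\: F1) :|: zeta @: Z1.
    apply/setP=> c; rewrite !(in_setU, in_setD).
    case: (boolP (c \in F1)) => cF /=.
      apply/esym/negbTE/imsetP=> -[v /setIdP[_ /negP vF] cv].
      by rewrite cv in cF.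
    congr (_ || _); apply/imsetP/imsetP=> -[v vZ cv]; exists v => //.
      by rewrite inE vZ -cv.
    by case/setIdP: vZ.
  have := cardsD reserve F1; rewrite (setIidPr F1_sub) e1 card_reserve.
  have [+ _] := leq_card_setU (A :\: F1) (zeta @: Z1).
  have -> : #|zeta @: Z1| = #|Z1|.
    apply: card_in_imset => u v; rewrite !inE => /andP[uZ _] /andP[vZ _].
    exact: zeta_inj.
  have := subset_leq_card F1_sub; rewrite card_reserve (cardsD R) (setIidPr Z1R).
  by move: room; rewrite -card_F1 -card_R; lia.
have [|rho [rhoI rhoA]] := @hall_set _ _ c0 (fun=> A :\: F1) (R :\: Z1).
  move=> B sB; have [->|/set0Pn[x xB]] := eqVneq B set0; first by rewrite cards0.
  apply: leq_trans (subset_leq_card sB) (leq_trans card_AF _).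
  exact: subset_leq_card (sub_nbhd (fun=> A :\: F1) xB).
pose f v := if h v is Some d then d else if e (p v) is Some c then c
            else if v \in Z1 then zeta v else rho v.
have inR v : h v = None -> e (p v) = None -> v \notin Z1 ->
    rho v \in A :\: F1 /\ v \in R :\: Z1.
  move=> hv ev vZ; have vR : v \in R :\: Z1 by rewrite in_setD vZ inE hv ev.
  by split=> //; apply: rhoA.
have AR : A \subset reserve by apply: subsetUl.
have f1 v : (f v \in reserve) = (h v == None).
  rewrite /f; case hv: (h v) => [d|].
    by have [_ /negPf-> _] := hL v d hv.
  case ev: (e (p v)) => [c|]; first by have [-> _ _] := eC _ _ ev.
  case: ifPn => vZ; first by rewrite inE imset_f ?orbT //; case/setIdP: vZ.
  by have [/setDP[/(subsetP AR)->]] := inR v hv ev vZ.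
have f2 v : h v = None -> (f v \in F1) = (e (p v) != None).
  move=> hv; rewrite /f hv; case ev: (e (p v)) => [c|].
    by apply/F1P; exists (p v).
  case: ifPn => vZ; first by case/setIdP: vZ => _ /negPf.
  by have [/setDP[_ /negPf]] := inR v hv ev vZ.
have f3 v : h v = None -> e (p v) = None -> (f v \in A) = (v \notin Z1).
  move=> hv ev; rewrite /f hv ev; case: ifPn => vZ.
    by case/setIdP: vZ => /zeta_L; rewrite inE => /andP[/negPf].
  by have [/setDP[->]] := inR v hv ev vZ.
(* By [f1], [f2] and [f3], equal colours arise at the same stage; a vertex coloured at the last
   stage is alone in its class. *)
have key u v : f u = f v -> p u = p v /\
    (h v = None -> e (p v) = None -> v \notin Z1 -> u = v).
  move=> fuv; have := f1 u; rewrite fuv f1.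
  case hv: (h v) => [d|]; case hu: (h u) => [d'|] //= _.
    split=> //; apply: (hp u v d) => //.
    by move: fuv; rewrite /f hu hv => <-.
  have := f2 u hu; rewrite fuv f2 //.
  case ev: (e (p v)) => [c|]; case eu: (e (p u)) => [c'|] //= _.
    split=> //; apply: (eI _ _ c) => //.
    by move: fuv; rewrite /f hu hv eu ev => <-.
  have := f3 u hu eu; rewrite fuv f3 //.
  case: (boolP (v \in Z1)) => vZ; case: (boolP (u \in Z1)) => uZ //= _.
    have : u = v; last by move->.
    move: fuv; rewrite /f hu hv eu ev uZ vZ.
    by case/setIdP: uZ vZ => uZ _ /setIdP[vZ _]; apply: zeta_inj.
  have : u = v; last by move->.
  move: fuv; rewrite /f hu hv eu ev (negPf uZ) (negPf vZ).
  by apply: rhoI; [case: (inR u) | case: (inR v)].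
apply: (@no_near_frequent f); split=> [u v|v].
  by apply: contra => /eqP/key[->].
case hv: (h v) => [d|].
  by left; have [dL _ _] := hL v d hv; rewrite /f hv.
case ev: (e (p v)) => [c|].
  left; have [_ _ /subsetP/(_ v)] := eC _ _ ev; rewrite /f hv ev !inE hv eqxx.
  by apply.
case: (boolP (v \in Z1)) => vZ.
  left; rewrite /f hv ev vZ; case/setIdP: vZ => /zeta_L.
  by rewrite inE => /andP[].
right; split; last by move=> u /key[_]; apply.
rewrite /f hv ev (negPf vZ); have [/setDP[rA _] _] := inR v hv ev vZ.
exact: (subsetP A_frequent).
Qed.

(** For a largest cover [e], of size [j], counting uncoloured vertices gives [|dom h| <= k - j],
    while a further part with two uncoloured vertices forces [|dom h| >= k - j]. Hence equality
    holds throughout. *)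
Lemma max_stuck h : max_partial h ->
  [/\ #|T| = 2 * k + 1, \sum_i #|unc h i| = k + 1,
      exists i, 1 < #|unc h i| &
      forall i, 1 < #|unc h i| -> unc h i = part i /\
        forall d, d \notin reserve -> #|holders d :&: part i| = #|class h d|].
Proof.
move=> hm; have [hh hmax] := hm.
have cov0 : reserve_cover h [ffun=> None].
  by split=> [i c|i j c]; rewrite !ffunE.
have [e [eC eI] emax] := ffun_argmax (fun e => #|assigned e|) cov0.
have few := reserve_cover_few hh (conj eC eI).
have sumE1 : 2 * #|assigned e| <= \sum_(i in assigned e) #|unc h i|.
  rewrite mulnC -sum_nat_const; apply: leq_sum => i; rewrite inE.
  by case ei: (e i) => [c|//] _; case: (eC i c ei).
have sumE : \sum_i #|unc h i| =
    \sum_(i in assigned e) #|unc h i| + \sum_(i in ~: assigned e) #|unc h i|.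
  rewrite (bigID (mem (assigned e))) /=; congr (_ + _); apply: eq_bigl => i.
  by rewrite !inE.
have domE := sum_unc h.
have le_dom : #|dom h| + #|assigned e| <= k by move: leT; lia.
have bound i : i \notin assigned e -> 1 < #|unc h i| ->
    [/\ assigned e = set0, #|dom h| = k, unc h i = part i &
     forall d, d \notin reserve -> #|holders d :&: part i| = #|class h d|].
  move=> iE i1; have ib := unc_big i1.
  pose W := unc h i.
  have hW c : #|[set v in W | c \in L v]| = #|holders c :&: W|.
    by apply: eq_card => v; rewrite !inE andbC.
  have LW : k * #|W| <= \sum_(c in reserve) #|holders c :&: W| +
                        \sum_(c in ~: reserve) #|holders c :&: W|.
    under eq_bigr do rewrite -hW; under [X in _ + X]eq_bigr do rewrite -hW.
    rewrite -!double_count -big_split mulnC -sum_nat_const.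
    by apply: leq_sum => v _ /=; rewrite -setDE cardsID.
  pose F1 := [set c | [exists j, e j == Some c]].
  have card_F1 : #|F1| <= #|assigned e|.
    rewrite -(card_imset _ (@Some_inj _ : injective (@Some C))).
    apply: leq_trans (leq_imset_card e _).
    apply/subset_leq_card/subsetP=> _ /imsetP[c + ->].
    by rewrite inE => /existsP[j /eqP ej]; rewrite -ej imset_f // inE ej.
  (* A reserve colour outside [F1] and common to [W] would extend [e]. *)
  have inF c : c \in reserve -> #|holders c :&: W| + 1 <= #|W| + (c \in F1).
    move=> cR; have [cF|cF] := boolP (c \in F1).
      by rewrite leq_add2r subset_leq_card ?subsetIr.
    rewrite addn0 addn1; apply: proper_card; rewrite properE subsetIr /=.
    rewrite subsetI subxx andbT; apply/negP=> Wc.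
    pose e' := [ffun j => if j == i then Some c else e j].
    have e'E j c' : e' j = Some c' -> (j = i /\ c' = c) \/ e j = Some c'.
      by rewrite ffunE; case: eqP => [-> [<-]|_]; [left | right].
    have ec j : e j <> Some c.
      by move=> ej; case/negP: cF; rewrite inE; apply/existsP; exists j; apply/eqP.
    have : reserve_cover h e'.
      split=> [j c' /e'E[[-> ->]|/eC]|j l c' /e'E ej /e'E el] //.
      case: ej => [[-> cc]|ej]; case: el => [[-> cc']|el] //.
      - by case: (ec l); rewrite -cc.
      - by case: (ec j); rewrite -cc'.
      - exact: eI ej el.
    move/emax => /=; rewrite leqNgt => /negP; apply.
    apply: proper_card; apply/properP; split.
      by apply/subsetP=> j; rewrite !inE ffunE; case: (j =P i).
    by exists i; rewrite // inE ffunE eqxx.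
  have sumF : \sum_(c in reserve) #|holders c :&: W| + k <= k * #|W| + #|F1|.
    rewrite -card_reserve -[X in _ + X <= _]sum1_card -big_split /=.
    apply: (@leq_trans (\sum_(c in reserve) (#|W| + (c \in F1)))).
      by apply: leq_sum => c; apply: inF.
    rewrite big_split sum_nat_const leq_add2l -sum1_card.
    rewrite big_mkcond [X in _ <= X]big_mkcond; apply: leq_sum => c _.
    by case: (c \in reserve); case: (c \in F1).
  have clsW c : c \in ~: reserve -> #|holders c :&: W| <= #|class h c|.
    by rewrite inE => cR; apply: max_class.
  have domC := dom_class hh.
  have sumC : \sum_(c in ~: reserve) #|holders c :&: W| <=
              \sum_(c in ~: reserve) #|class h c| by apply: leq_sum.
  have eqW : forall c, c \in ~: reserve -> #|holders c :&: W| = #|class h c|.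
    by apply: sum_leq_eq => //; move: LW sumF; lia.
  (* A colour [d] present in the part has a nonempty class but, by [max_inside], no holder in [W],
     against [eqW]. *)
  have Wi : W = part i.
    apply/eqP; rewrite eqEsubset unc_part /=; apply/subsetP=> v vi.
    case hv: (h v) => [d|]; last by move: vi; rewrite !inE hv eqxx andbT.
    have [_ dR _] := hh.1 v d hv.
    have := eqW d; rewrite inE dR => /(_ isT).
    rewrite (max_inside hm dR ib hv vi) cards0 => /esym/eqP.
    by rewrite cards_eq0 => /eqP/setP/(_ v); rewrite !inE hv eqxx.
  (* Now that [W] is a whole part, no reserve colour is common to it, not even one in [F1];
     repeating the count forces [assigned e] to be empty. *)
  have sumF0 : \sum_(c in reserve) #|holders c :&: W| + k <= k * #|W|.
    rewrite -card_reserve -[X in _ + X <= _]sum1_card -big_split -sum_nat_const.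
    apply: leq_sum => c _ /=; rewrite addn1; apply: proper_card.
    rewrite properE subsetIr /= subsetI subxx andbT.
    move: ib; rewrite inE => /no_common_color-/(_ c)[v [vi cv]].
    by apply/subsetPn; exists v; rewrite ?Wi // inE.
  have E0 : #|assigned e| = 0 by move: LW; lia.
  split=> //; [exact: cards0_eq | by move: LW; lia | move=> d dR].
  by rewrite -Wi eqW // inE.
have [i [iE i1]] : exists i, i \notin assigned e /\ 1 < #|unc h i|.
  apply: contrapT => no.
  have : \sum_(i in ~: assigned e) #|unc h i| <= #|~: assigned e|.
    rewrite -sum1_card; apply: leq_sum => i; rewrite inE => ie.
    by rewrite leqNgt; apply/negP=> i1; apply: no; exists i.
  by have := cardsC (assigned e); rewrite card_ord; lia.
have [E0 domk _ _] := bound i iE i1.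
rewrite E0 cards0 in few sumE1 sumE.
rewrite big_set0 in sumE.
split; [by move: leT; lia | by move: leT; lia | by exists i | move=> j j1].
by have [|_ _ ? ?] := bound j _ j1; rewrite ?E0 ?inE.
Qed.

(** * The tight case: moving colours between parts *)

Lemma unc_move h d i j : j != i ->
  unc (move h d i) j = unc h j :|: class h d :&: part j.
Proof.
move=> ji; apply/setP=> v; rewrite !inE ffunE !inE.
case: (eqVneq (p v) j) => [->|_] /=; last by rewrite andbF.
rewrite (negPf ji) andbF andbT.
by case: (eqVneq (h v) (Some d)) => [->|]; rewrite ?eqxx ?orbT ?orbF.
Qed.

Lemma unc_move_same h d i : unc h i = part i ->
  unc (move h d i) i = part i :\: holders d.
Proof.
move=> ui; apply/setP=> v; rewrite !inE ffunE.
have [/eqP vi|vi] := boolP (p v == i); last by rewrite andbF.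
have vu : v \in unc h i by rewrite ui inE vi.
have hv : h v = None by move: vu; rewrite inE => /andP[_ /eqP].
by rewrite inE vu !inE hv andbT; case: (d \in L v).
Qed.

Lemma max_move h d i : max_partial h -> d \notin reserve -> 1 < #|unc h i| ->
  max_partial (move h d i).
Proof.
move=> hm dR i1; have [hh hmax] := hm; split.
  exact: partial_move hh dR (unc_big i1).
move=> h' /hmax/leq_trans; apply.
have [_ _ _ /(_ i i1)[ui /(_ d dR) cls]] := max_stuck hm.
by have := dom_move h d i; rewrite ui cls; lia.
Qed.

Lemma stuck_small h i : max_partial h -> 1 < #|unc h i| -> #|part i| <= 2.
Proof.
move=> hm i1; rewrite leqNgt; apply/negP=> i3.
have [_ sumk _ stuck] := max_stuck hm; have [ui clsi] := stuck i i1.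
suff ge1 j : j != i -> 1 <= #|unc h j|.
  have : \sum_(j | j != i) 1 <= \sum_(j | j != i) #|unc h j| by apply: leq_sum.
  rewrite sum1_card cardC1 card_ord.
  by move: sumk; rewrite (bigD1 i) //= ui; have := k_gt0; lia.
move=> ji; rewrite lt0n cards_eq0; apply/negP=> /eqP uj.
have /card_gt0P[v vj] := part_gt0 j.
case hv: (h v) => [d|]; last first.
  by have := in_set0 v; rewrite -uj inE vj hv eqxx.
have [_ dR _] := hm.1.1 v d hv.
have hm' := max_move hm dR i1; have [_ _ _ stuck'] := max_stuck hm'.
have sub : class h d \subset part j.
  apply/subsetP=> u; rewrite !inE => /eqP hu; move: vj; rewrite inE.
  by rewrite (hm.1.2 u v d).
have vd : v \in class h d by rewrite inE hv.
have small : #|part i :\: holders d| <= 1.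
  rewrite leqNgt; apply/negP; rewrite -(unc_move_same d ui) => /stuck'[+ _].
  rewrite (unc_move_same d ui) => e; have := clsi d dR.
  have -> : holders d :&: part i = set0.
    by rewrite -e; apply/setP=> u; rewrite !inE; case: (d \in L u).
  rewrite cards0 => /esym/eqP; rewrite cards_eq0 => /eqP c0.
  by rewrite c0 inE in vd.
have cls2 : 1 < #|class h d|.
  have := cardsID (holders d) (part i); rewrite setIC clsi //; lia.
have uj' : unc (move h d i) j = class h d.
  by rewrite unc_move // uj set0U (setIidPl sub).
have [|e _] := stuck' j; first by rewrite uj'.
rewrite uj' in e; have [|w [+ dw]] := @no_common_color j d; first by rewrite -e.
by rewrite -e inE => /eqP hw; have [] := hm.1.1 w d hw; rewrite (negPf dw).
Qed.

(** As [|T| = 2 * k + 1], some part [j] has three vertices, and by [stuck_small] every maximal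
    partial colouring leaves at most one of them uncoloured. Moving two colours of [j] away, one
    after the other, leaves two uncoloured. *)
Lemma extension_absurd : False.
Proof.
have p0 : partial [ffun=> None].
  by split=> [v c|u v c]; rewrite !ffunE.
have [h hh hmax] := ffun_argmax (fun h => #|dom h|) p0.
have hm : max_partial h by [].
have [cT _ [i i1] stuck] := max_stuck hm.
have [j j3] : exists j, 2 < #|part j|.
  apply: contrapT => no; have : \sum_j #|part j| <= \sum_(j < k) 2.
    apply: leq_sum => j _; rewrite leqNgt.
    by apply/negP=> j3; apply: no; exists j.
  by rewrite -card_T_parts sum_nat_const card_ord cT; lia.
have small g l : max_partial g -> 2 < #|part l| -> #|unc g l| <= 1.
  move=> gm l3; rewrite leqNgt; apply/negP=> l1.
  by have := stuck_small gm l1; lia.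
have : 1 < #|part j :\: unc h j|.
  by rewrite cardsD (setIidPr (unc_part h j)); have := small h j hm j3; lia.
move=> /card_gt1P[y1 [y2 [/setDP[y1j y1u] /setDP[y2j y2u] y12]]].
have colored y : y \in part j -> y \notin unc h j -> exists d, h y = Some d.
  by move=> yj; rewrite inE yj; case: (h y) => // d _; exists d.
have [d1 hy1] := colored y1 y1j y1u; have [d2 hy2] := colored y2 y2j y2u.
have [_ d1R _] := hh.1 y1 d1 hy1; have [_ d2R _] := hh.1 y2 d2 hy2.
have [ui clsi] := stuck i i1.
have ji : j != i.
  by apply: contraTneq (stuck_small hm i1) => <-; rewrite -ltnNge.
have d12 : d2 != d1.
  apply/eqP=> e; have : #|holders d1 :&: part i| < #|part i|.
    apply: proper_card; rewrite properE subsetIr subsetI subxx andbT /=.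
    have [|v [vi dv]] := @no_common_color i d1; first by rewrite -ui.
    by apply/subsetPn; exists v; rewrite // inE.
  have : 1 < #|class h d1|.
    by apply/card_gt1P; exists y1, y2; split=> //; rewrite inE ?hy1 ?hy2 ?e.
  by rewrite clsi //; have := stuck_small hm i1; lia.
have hm' := max_move hm d1R i1; set h' := move h d1 i in hm'.
have hy2' : h' y2 = Some d2.
  have : y2 \notin unc h i by rewrite inE hy2 andbF.
  rewrite ffunE in_setI => /negPf->; rewrite andbF hy2.
  by case: eqP => // -[/eqP]; rewrite (negPf d12).
have [_ _ [l l1] stuck'] := max_stuck hm'.
have jl : j != l.
  by apply: contraTneq (stuck_small hm' l1) => <-; rewrite -ltnNge.
have hm'' := max_move hm' d2R l1.
have := small _ j hm'' j3; rewrite leqNgt => /negP; apply.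
apply/card_gt1P; exists y1, y2; split=> //; rewrite unc_move // !in_setU.
  rewrite unc_move // !in_setU !in_setI y1j [y1 \in class h d1]inE hy1.
  by rewrite eqxx orbT.
by rewrite in_setI y2j [y2 \in class _ _]inE hy2' eqxx orbT.
Qed.

End Extension.

Lemma minimal_absurd : False.
Proof.
have [c0 _] := C_inhabited; have kFs := frequent_or_single.
have [kF|kF] := leqP k #|frequent|.
  have [A [AF Ak]] := subset_of_card kF.
  apply: (@extension_absurd A set0 (fun=> c0)) => //; first exact: sub0set.
  - by move=> u v; rewrite inE.
  - by move=> v; rewrite inE.
  - by rewrite cards0 addn0.
have [|Z [ZS Zk]] := @subset_of_card _ singles (k - #|frequent|); first by lia.
(* Each list keeps at least [k - |frequent| = |Z|] colours, so Hall's condition is immediate. *)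
have [|zeta [zI zL]] := @hall_set _ _ c0 (fun v => L v :\: frequent) Z.
  move=> B sB; have [->|/set0Pn[x xB]] := eqVneq B set0; first by rewrite cards0.
  apply: leq_trans (subset_leq_card sB) _; rewrite Zk.
  apply: leq_trans (subset_leq_card (sub_nbhd _ xB)).
  by rewrite cardsD leq_sub // subset_leq_card ?subsetIr.
by apply: (@extension_absurd frequent Z zeta) => //; rewrite Zk; lia.
Qed.

End MinimalCounterexample.

(** * Reduction to a minimal counterexample *)

Definition multipartite_choosable_below n := forall (T C I : finType)
  (p : T -> I) (L : T -> {set C}) k, #|T| < n -> #|T| <= 2 * k + 1 ->
  #|p @: setT| <= k -> (forall v, k <= #|L v|) ->
  exists f, part_coloring p L setT f.

Lemma sub_part_coloring n (T C I : finType) (p : T -> I) (L : T -> {set C})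
    (D : {set T}) k : multipartite_choosable_below n -> 0 < #|C| ->
  #|D| < n -> #|D| <= 2 * k + 1 -> #|p @: D| <= k ->
  {in D, forall v, k <= #|L v|} -> exists f, part_coloring p L D f.
Proof.
move=> IHn /card_gt0P[c0 _] ltD leD pD LD.
pose S : finType := {v : T | v \in D}.
have cS : #|S| = #|D| by rewrite card_sig.
have [||||f [fp fL]] := IHn S C I (p \o val) (L \o val) k; rewrite ?cS //.
- apply: leq_trans pD; apply/subset_leq_card/subsetP=> _ /imsetP[u _ ->] /=.
  exact: imset_f (valP u).
- by move=> u; apply: LD; apply: valP.
exists (fun v => if insub v is Some u then f u else c0).
split=> [u v uD vD|v vD].
  by rewrite !insubT /= => puv; apply: fp.
by rewrite insubT; apply: (fL (exist _ v vD)).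
Qed.

Lemma multipartite_choosable n : multipartite_choosable_below n.
Proof.
elim: n => // n IHn T C I p L k ltT leT pk Lk; apply: contrapT => bad.
have [x0 _|T0] := pickP (@predT T); last first.
  have no (v : T) : False by have := T0 v.
  by case: bad; exists (fun v => False_rect C (no v)); split=> v; case: (no v).
have kpos : 0 < k.
  by apply: leq_trans pk; apply/card_gt0P; exists (p x0); apply: imset_f.
(* Restricting the palette to the colours in use secures [L_cover]. *)
pose C1 : finType := {c : C | c \in \bigcup_v L v}.
pose L1 v : {set C1} := [set c | val c \in L v].
have L1k v : k <= #|L1 v|.
  apply: leq_trans (Lk v) _; rewrite -(card_imset _ val_inj).
  apply/subset_leq_card/subsetP=> c cv.
  have cU : c \in \bigcup_v L v by apply/bigcupP; exists v.
  by apply/imsetP; exists (exist _ c cU); rewrite ?inE.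
have cover1 c : exists v, c \in L1 v.
  by case: c => c cU; case/bigcupP: (cU) => v _ cv; exists v; rewrite inE.
have C1pos : 0 < #|C1|.
  by apply: leq_trans kpos (leq_trans (L1k x0) _); apply: max_card.
pose q0 v := widen_ord pk (enum_rank_in (imset_f p (in_setT x0)) (p v)).
have q0P u v : q0 u = q0 v -> p u = p v.
  move/(congr1 val) => /= /ord_inj; apply: enum_rank_in_inj; exact: imset_f.
pose badp (q : {ffun T -> 'I_k}) := ~ exists f, part_coloring q L1 setT f.
have bad0 : badp (finfun q0).
  move=> [f [fp fL]]; apply: bad; exists (val \o f).
  split=> [u v _ _ puv|v _] /=.
    rewrite (inj_eq val_inj); apply: fp; rewrite ?inE // !ffunE.
    by apply: contra puv => /eqP/q0P->.
  by have := fL v (in_setT v); rewrite inE.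
have [q badq qmax] :=
  ffun_argmax (fun q : {ffun T -> 'I_k} => #|q @: setT|) bad0.
have qsurj i : exists v, q v = i.
  apply: contrapT => iq.
  have iq' : i \notin q @: setT.
    by apply/imsetP=> -[v _ iv]; apply: iq; exists v.
  have ltq : #|q @: setT| < k.
    rewrite -[X in _ < X]card_ord -cardsT proper_card // properT.
    by apply: contraNneq iq' => ->.
  have [qI|] := boolP (injectiveb q).
    have ltTk : #|T| < k.
      by move: ltq; rewrite card_imset ?cardsT //; apply/injectiveP.
    have /card_gt0P[c0 _] := C1pos.
    have [|f [fI fL]] := @hall _ _ c0 L1.
      move=> B; have [->|/set0Pn[x xB]] := eqVneq B set0; first by rewrite cards0.
      apply: leq_trans (max_card _) (leq_trans (ltnW ltTk) _).
      exact: leq_trans (L1k x) (subset_leq_card (sub_nbhd _ xB)).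
    apply: badq; exists f; split=> [u v _ _|v _] //.
    by apply: contra => /eqP/fI->.
  case/injectivePn=> u [v uv quv].
  pose q' := [ffun w => if w == u then i else q w].
  have q'E w z : q w != q z -> q' w != q' z.
    rewrite !ffunE; case: (w =P u) => [->|_]; case: (z =P u) => [->|_] //.
    - by rewrite eqxx.
    - by move=> _; apply: contraNneq iq' => ->; apply: imset_f.
    - by move=> _; apply: contraNneq iq' => <-; apply: imset_f.
  have bad' : badp q'.
    move=> [f [fp fL]]; apply: badq; exists f; split=> // w z wT zT /q'E.
    exact: fp.
  have := qmax _ bad'; rewrite leqNgt => /negP; apply.
  apply: proper_card; apply/properP; split.
    apply/subsetP=> _ /imsetP[w _ ->].
    have [->|wu] := eqVneq w u; apply/imsetP; last first.
      by exists w; rewrite // ffunE (negPf wu).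
    by exists v; rewrite // ffunE quv eq_sym (negPf uv).
  by exists i => //; apply/imsetP; exists u; rewrite // ffunE eqxx.
pose badL (M : {ffun T -> {set C1}}) :=
  [/\ ~ exists f, part_coloring q M setT f, forall v, k <= #|M v| &
      forall c, exists v, c \in M v].
have badL1 : badL (finfun L1).
  split=> [[f [fp fL]]|v|c].
  - by apply: badq; exists f; split=> // v /fL; rewrite ffunE.
  - by rewrite ffunE.
  - by have [v cv] := cover1 c; exists v; rewrite ffunE.
have [M [badM Mk Mc] Mmax] :=
  ffun_argmax (fun M : {ffun T -> {set C1}} => \sum_v #|M v|) badL1.
apply: (@minimal_absurd T C1 k q M) => //.
  move=> D L' k' ltD; apply: (sub_part_coloring IHn) => //.
  exact: leq_trans ltD ltT.
move=> v c cv; apply: contrapT => no.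
pose M' := [ffun u => if u == v then c |: M u else M u].
have sub u : M u \subset M' u.
  by rewrite ffunE; case: ifP => // _; apply: subsetUr.
have badM' : badL M'.
  split=> [[f [fp fL]]|u|d].
  - apply: no; exists f; split=> [u w quw|u]; first by apply: fp; rewrite ?inE.
    have := fL u (in_setT u); rewrite ffunE; case: eqP => [->|_]; last by left.
    by rewrite !inE => /orP[/eqP|]; [right | left].
  - exact: leq_trans (Mk u) (subset_leq_card (sub u)).
  - by have [u du] := Mc d; exists u; apply: (subsetP (sub u)).
have := Mmax _ badM'; rewrite leqNgt => /negP; apply.
rewrite (bigD1 v) //= [X in _ < X](bigD1 v) //= -addSn leq_add //.
  by rewrite ffunE eqxx cardsU1 cv.
by apply: leq_sum => u _; apply: subset_leq_card.
Qed.

Theorem theorem4p60 (G : sgraph) :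
  #|G| <= 2 * chromatic_number G + 1 ->
  choice_number G = chromatic_number G.
Proof.
rewrite /choice_number /chromatic_number.
case: ex_minnP => k /existsP[p pG] kmin leG.
case: ex_minnP => m /asboolP chm mmin.
apply/eqP; rewrite eqn_leq; apply/andP; split.
  (* The colour classes of an optimal colouring [p] serve as the parts. *)
  apply: mmin; apply/asboolP=> C L Lk.
  have [|||f [fp fL]] :=
      multipartite_choosable (ltnSn #|G|) (p := p) (L := L) (k := k) => //.
    by rewrite (leq_trans (max_card _)) // card_ord.
  exists f; split=> [|v]; last by apply: fL; rewrite inE.
  apply/forallP=> x; apply/forallP=> y; apply/implyP=> xy.
  apply: fp; rewrite ?inE //.
  by move: pG => /forallP/(_ x)/forallP/(_ y)/implyP/(_ xy).
apply: kmin; have [v|f [fG _]] := chm 'I_m (fun=> setT).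
  by rewrite cardsT card_ord.
apply/existsP; exists (finfun f); apply/forallP=> x; apply/forallP=> y.
by rewrite !ffunE; move: fG => /forallP/(_ x)/forallP/(_ y).
Qed.
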